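(* Let $P(X)=X^N-\sum_{j=1}^N b_jX^{N-j}$ be a silver polynomial of degree $N$ which is irreducible over $\mathbb Q$, and assume that its silver number $\rho$ is a Pisot number. Then the following are equivalent: (1) There exists $L>0$ such that the set of $\rho$-integers is the set of endpoints of a tiling of $[0,\infty)$ that is subordinate to some tiling of $[0,\infty)$ whose prototiles have lengths $L, L/\rho,\dots,L/\rho^{N-1}$. (2) The set $\{x-y: x,y\ \rho\text{-integers}\}$ of differences of $\rho$-integers does not have $0$ as a cluster point.
   Context: A silver polynomial of degree $N\geq2$ is $X^N-\sum_{j=1}^Nb_jX^{N-j}$ with all $b_j\in\{0,1\}$, $b_N=1$ and $\sum_jb_j>1$; its silver number $\rho$ is its largest positive real root (it lies in $(1,2)$). A Pisot number is a real algebraic integer $>1$ all of whose other conjugates (roots of its minimal polynomial) have modulus $<1$. A non-negative real number is a $\rho$-integer if it equals $\sum_{i=0}^{n}c_i\rho^{n-i}$ for some $n\in\mathbb N_0$ and $c_i\in\{0,1\}$. A tiling of $[0,\infty)$ is given by a strictly increasing sequence of endpoints $0=y_0<y_1<\cdots\to\infty$, the tiles $[y_{i-1},y_i]$ having only finitely many distinct lengths (the prototile lengths). A tiling $\mathcal T'$ is subordinate to $\mathcal T$ if every endpoint of $\mathcal T'$ is an endpoint of $\mathcal T$. *)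

(* Defs.v *)
From HB Require Import structures.
From mathcomp Require Import all_boot all_order all_algebra.
From mathcomp Require Import complex.
From mathcomp Require Import all_classical all_reals.
From mathcomp Require Import topology normedtype sequences.

Set Implicit Arguments.
Unset Strict Implicit.
Unset Printing Implicit Defensive.

Import Order.TTheory GRing.Theory Num.Theory.
Import numFieldNormedType.Exports.

Local Open Scope classical_set_scope.
Local Open Scope ring_scope.

(* The coefficients b_1, ..., b_N are given by b : nat -> bool; the values of b
   outside 1..N are irrelevant. *)
Definition silver_poly (N : nat) (b : nat -> bool) : {poly rat} :=
  'X^N - \sum_(1 <= j < N.+1) (b j)%:R *: 'X^(N - j).

Definition silver_coefs (N : nat) (b : nat -> bool) : Prop :=
  [/\ (2 <= N)%N, b N & (1 < \sum_(1 <= j < N.+1) b j)%N].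

Definition is_silver_number (R : realType) (P : {poly rat}) (rho : R) : Prop :=
  [/\ 0 < rho, root (map_poly ratr P) rho &
      forall x : R, 0 < x -> root (map_poly ratr P) x -> x <= rho].

Definition is_minpoly (R : realType) (p : {poly rat}) (x : R) : Prop :=
  p \is monic /\ forall q : {poly rat}, root (map_poly ratr q) x = (p %| q).

Definition conjugate (R : realType) (x : R) (z : complex R) : Prop :=
  exists2 p : {poly rat}, is_minpoly p x & root (map_poly ratr p) z.

(* The norm of z : complex R is itself an element of complex R. *)
Definition pisot (R : realType) (x : R) : Prop :=
  [/\ integralOver (intr : int -> R) x, 1 < x &
      forall z : complex R, conjugate x z -> z <> (x%:C)%C -> `|z| < 1].

Definition rho_integers (R : realType) (rho : R) : set R :=
  [set x | 0 <= x /\ exists (n : nat) (c : 'I_n.+1 -> bool),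
     x = \sum_(i < n.+1) (c i)%:R * rho ^+ (n - i)].

Definition difference_set (R : realType) (A : set R) : set R :=
  [set z | exists x y : R, [/\ A x, A y & z = x - y]].

(* A tiling of [0, +oo[ is represented by its sequence of endpoints. *)
Definition endpoints (R : realType) (y : nat -> R) : set R := range y.

Definition prototile_lengths (R : realType) (y : nat -> R) : set R :=
  range (fun i : nat => y i.+1 - y i).

Definition tiling (R : realType) (y : nat -> R) : Prop :=
  [/\ y 0%N = 0, forall i : nat, y i < y i.+1, y @ \oo --> +oo &
      finite_set (prototile_lengths y)].

Definition subordinate (R : realType) (y' y : nat -> R) : Prop :=
  endpoints y' `<=` endpoints y.

(* Main.v *)
Require Import Defs.
From HB Require Import structures.
From mathcomp Require Import all_boot all_order all_algebra.
From mathcomp Require Import complex.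
From mathcomp Require Import all_classical all_reals.
From mathcomp Require Import topology normedtype sequences.
From mathcomp Require Import ring lra zify.

Set Implicit Arguments.
Unset Strict Implicit.
Unset Printing Implicit Defensive.

Import Order.TTheory GRing.Theory Num.Theory.
Import numFieldNormedType.Exports.

Local Open Scope classical_set_scope.
Local Open Scope ring_scope.

(* Both conditions hold for every irreducible silver polynomial with Pisot root rho.
   Write elements of Z[rho] in the basis 1, rho^-1, ..., rho^-(N-1): multiplication by rho
   becomes the nonnegative companion map T, which has a positive eigenvector for rho. On the
   complementary hyperplane (vectors of value 0) the orbits of T are absolutely summable,
   because the other roots of P lie in the open unit disc.
   Hence the coordinates of a difference sum_i c_i rho^i, c_i in {-1,0,1}, are bounded in
   terms of its absolute value: only finitely many differences lie in [-1,1], which gives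
   (2) and the finiteness of the set of gaps between consecutive rho-integers (gaps are at
   most 1 by the greedy algorithm, as rho < 2). Moreover T^m a is entrywise positive for
   large m as soon as a has positive value, so for a common m every gap g satisfies
   rho^m g = sum_k n_k rho^-k with integers n_k > 0, and L = rho^-m works in (1). *)

(** * Linear recurrences and absolute summability *)

Section Recurrences.
Variable K : numFieldType.
Implicit Types (p q : {poly K}) (u : nat -> K).

(** This is [p(S) u] at [m], for [S] the shift on sequences; [u] satisfies the recurrence with
    characteristic polynomial [p] when it vanishes for all [m]. *)
Definition shift_op p u (m : nat) : K := \sum_(i < size p) p`_i * u (m + i)%N.

Lemma shift_op_widen n p u m : (size p <= n)%N ->
  shift_op p u m = \sum_(i < n) p`_i * u (m + i)%N.
Proof.
move=> le_pn; rewrite /shift_op (big_ord_widen _ (fun i => p`_i * u (m + i)%N) le_pn).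
rewrite big_mkcond; apply: eq_bigr => i _; case: ltnP => // le_pi.
by rewrite nth_default ?mul0r.
Qed.

Lemma shift_opD p q u m : shift_op (p + q) u m = shift_op p u m + shift_op q u m.
Proof.
have le_pq := size_polyD p q; rewrite (shift_op_widen _ _ le_pq).
rewrite (shift_op_widen (p := p) _ _ (leq_maxl _ (size q))).
rewrite (shift_op_widen (p := q) _ _ (leq_maxr (size p) _)) -big_split.
by apply: eq_bigr => i _; rewrite coefD mulrDl.
Qed.

Lemma shift_opZXn c k u m : shift_op (c *: 'X^k) u m = c * u (m + k)%N.
Proof.
have le_k : (size (c *: 'X^k : {poly K}) <= k.+1)%N.
  by rewrite (leq_trans (size_scale_leq _ _)) // size_polyXn.
rewrite (shift_op_widen _ _ le_k) big_ord_recr /= big1 ?add0r.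
  by rewrite coefZ coefXn eqxx mulr1.
by move=> i _; rewrite coefZ coefXn (ltn_eqF (ltn_ord i)) mulr0 mul0r.
Qed.

Lemma shift_op0 u m : shift_op 0 u m = 0.
Proof. by rewrite /shift_op size_poly0 big_ord0. Qed.

Lemma shift_op_sum (I : Type) (r : seq I) (F : I -> {poly K}) u m :
  shift_op (\sum_(i <- r) F i) u m = \sum_(i <- r) shift_op (F i) u m.
Proof.
by elim: r => [|i r IHr]; rewrite ?big_nil ?shift_op0 // !big_cons shift_opD IHr.
Qed.

(** Multiplicativity of [p(S)] for one linear factor: [S - z] is applied to [u] first. This strips
    roots off a recurrence one by one. *)
Lemma shift_op_XsubC z p u m :
  shift_op (('X - z%:P) * p) u m = shift_op p (fun i => u i.+1 - z * u i) m.
Proof.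
have le_sz : (size (('X - z%:P) * p)%R <= (size p).+1)%N.
  by rewrite (leq_trans (size_polyMleq _ _)) // size_XsubC.
rewrite (shift_op_widen _ _ le_sz).
under eq_bigr do rewrite mulrBl coefB coefXM coefCM mulrBl.
rewrite sumrB big_ord_recl big_ord_recr /= mul0r add0r (nth_default _ (leqnn _)).
rewrite mulr0 mul0r addr0 -sumrB; apply: eq_bigr => i _.
by rewrite addnS; ring.
Qed.

(** Bounded partial sums avoid limits, so the notion serves real and complex sequences alike. *)
Definition summable_seq u : Prop := exists B : K, forall n, \sum_(m < n) `|u m| <= B.

Lemma summable_seqD (u v : nat -> K) :
  summable_seq u -> summable_seq v -> summable_seq (fun m => u m + v m).
Proof.
move=> [B hB] [C hC]; exists (B + C) => n; apply: le_trans (lerD (hB n) (hC n)).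
by rewrite -big_split; apply: ler_sum => i _; apply: ler_normD.
Qed.

Lemma summable_seqZ c u : summable_seq u -> summable_seq (fun m => c * u m).
Proof.
move=> [B hB]; exists (`|c| * B) => n.
under eq_bigr do rewrite normrM.
by rewrite -mulr_sumr ler_wpM2l.
Qed.

Lemma summable_seq_shift u : summable_seq u -> summable_seq (fun m => u m.+1).
Proof.
move=> [B hB]; exists B => n; apply: le_trans (hB n.+1).
by rewrite big_ord_recl lerDr.
Qed.

Lemma summable_seq_sum n (F : nat -> nat -> K) :
  (forall k, (k < n)%N -> summable_seq (F k)) ->
  summable_seq (fun m => \sum_(k < n) F k m).
Proof.
elim: n => [_|n IHn hF].
  by exists 0 => n; rewrite big1 // => i _; rewrite big_ord0 normr0.
under eq_fun do rewrite big_ord_recr.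
by apply: summable_seqD; [apply: IHn => k /ltnW/hF | apply: hF].
Qed.

Lemma summable_seq_bounded u : summable_seq u -> exists B : K, forall m, `|u m| <= B.
Proof.
move=> [B hB]; exists B => m; apply: le_trans (hB m.+1).
by rewrite big_ord_recr lerDr sumr_ge0.
Qed.

(** Summing [|u (m+1)| <= |u (m+1) - z u m| + |z| |u m|] over [m], the last sum is absorbed on the
    left since [|z| < 1]. *)
Lemma summable_seq_XsubC z u : `|z| < 1 ->
  summable_seq (fun m => u m.+1 - z * u m) -> summable_seq u.
Proof.
move=> z_lt1 [B hB]; exists ((`|u 0%N| + B) / (1 - `|z|)) => n.
rewrite ler_pdivlMr ?subr_gt0 // mulrBr mulr1 lerBlDr.
have: \sum_(m < n.+1) `|u m| <= `|u 0%N| + (B + (\sum_(m < n) `|u m|) * `|z|).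
  rewrite big_ord_recl lerD2l; apply: le_trans (lerD (hB n) (lexx _)).
  rewrite mulr_suml -big_split; apply: ler_sum => i _ /=.
  rewrite [`|u i| * _]mulrC -normrM.
  by have := ler_normD (u i.+1 - z * u i) (z * u i); rewrite subrK.
by rewrite addrA; apply: le_trans; rewrite big_ord_recr lerDl.
Qed.

Lemma summable_seq_roots (rs : seq K) u : (forall z, z \in rs -> `|z| < 1) ->
  (forall m, shift_op (\prod_(z <- rs) ('X - z%:P)) u m = 0) -> summable_seq u.
Proof.
elim: rs u => [|z rs IHrs] u rs_lt1 hu.
  exists 0 => n; rewrite big1 // => i _; have := hu i.
  by rewrite big_nil /shift_op size_poly1 big_ord1 coef1 mul1r addn0 => ->; rewrite normr0.
apply: (@summable_seq_XsubC z); first by apply: rs_lt1; rewrite mem_head.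
apply: IHrs => [x xrs|m]; first by apply: rs_lt1; rewrite inE xrs orbT.
by rewrite -shift_op_XsubC -(big_cons _ _ z rs xpredT).
Qed.

End Recurrences.

(** * Splitting off the Pisot root over the complex numbers *)

Section PisotSplitting.
Variable R : realType.
Implicit Types (P : {poly rat}) (rho : R).

Lemma complex_summable (u : nat -> R) :
  summable_seq (fun m => ((u m)%:C)%C : complex R) -> summable_seq u.
Proof.
move=> [B hB]; exists (complex.Re B) => n; have := hB n.
have -> : \sum_(m < n) `|((u m)%:C)%C| = ((\sum_(m < n) `|u m|)%:C)%C :> complex R.
  rewrite rmorph_sum; apply: eq_bigr => m _.
  by rewrite normc_def /= expr0n /= addr0 sqrtr_sqr.
by rewrite lecE => /andP[].
Qed.

(** If [q] vanishes at [rho], so does [gcdp P q]; it is then not constant, hence associated to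
    [P]. *)
Lemma irreducible_minpoly P rho : P \is monic -> irreducible_poly P ->
  root (map_poly ratr P) rho -> is_minpoly P rho.
Proof.
move=> mP [szP irrP] rootP; split=> // q; apply/idP/idP; last first.
  by case/dvdpP=> s ->; rewrite rmorphM rootM rootP orbT.
move=> rootq; have: root (map_poly ratr (gcdp P q)) rho.
  by rewrite gcdp_map root_gcd rootP.
move=> rootg; have : gcdp P q %= P.
  apply: irrP (dvdp_gcdl P q); apply/negP => /size_poly1P[c c0 gE].
  by move: rootg; rewrite gE map_polyC rootC fmorph_eq0 (negbTE c0).
by move=> /andP[_ /dvdp_trans]; apply; apply: dvdp_gcdr.
Qed.

Lemma deriv_root_neq0 P rho : irreducible_poly P -> is_minpoly P rho ->
  ~~ root (map_poly ratr P^`()) rho.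
Proof.
move=> [szP _] [mP minP]; rewrite minP; apply/negP => /dvdp_leq.
have P0 : P != 0 by rewrite -size_poly_gt0 ltnW.
have dP0 : P^`() != 0.
  (* The top coefficient of the derivative is the leading coefficient of [P] times its degree,
     nonzero in characteristic 0. *)
  apply/eqP => /(congr1 (fun p : {poly rat} => p`_(size P).-2)).
  rewrite coef_deriv coef0 => /eqP; rewrite mulrn_eq0 /=.
  move: mP; rewrite monicE lead_coefE; case: (size P) szP => [|[|n]] //= _ /eqP->.
  by rewrite oner_eq0.
by move=> /(_ dP0); rewrite leqNgt lt_size_deriv.
Qed.

Lemma pisot_splitting P rho : P \is monic -> irreducible_poly P ->
    root (map_poly ratr P) rho -> pisot rho ->
  exists2 rs : seq (complex R),
    map_poly ratr P = ('X - ((rho%:C)%C)%:P) * \prod_(z <- rs) ('X - z%:P) &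
    forall z, z \in rs -> `|z| < 1.
Proof.
move=> mP irrP rootP [_ _ conj_lt1].
have minP := irreducible_minpoly mP irrP rootP.
have mapC (q : {poly rat}) :
    map_poly ratr q = map_poly (real_complex R) (map_poly ratr q) :> {poly complex R}.
  by rewrite -map_poly_comp; apply: eq_map_poly => x /=; rewrite fmorph_rat.
have [rs] := closed_field_poly_normal (map_poly ratr P : {poly complex R}).
rewrite (monicP (monic_map _ mP)) scale1r => PE.
have rho_rs : (rho%:C)%C \in rs.
  by rewrite -root_prod_XsubC -PE mapC fmorph_root.
have {}PE : map_poly ratr P =
    ('X - ((rho%:C)%C)%:P) * \prod_(z <- rem (rho%:C)%C rs) ('X - z%:P).
  by rewrite PE (perm_big _ (perm_to_rem rho_rs)) big_cons.
exists (rem (rho%:C)%C rs) => // z z_rs; apply: conj_lt1.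
  by exists P => //; rewrite PE rootM root_prod_XsubC z_rs orbT.
(* A second occurrence of [rho] among the roots would make the derivative vanish at [rho]. *)
move=> zE; rewrite zE in z_rs; move: (deriv_root_neq0 irrP minP).
rewrite -(fmorph_root (real_complex R)) -mapC -deriv_map PE derivM.
rewrite rootE !hornerE /= subrr mul0r addr0 derivXsubC hornerC mul1r.
by rewrite -rootE root_prod_XsubC z_rs.
Qed.

End PisotSplitting.

(** * The companion map, its eigenvector and its orbits *)

Section Companion.
Variables (R : realType) (N : nat) (b : nat -> bool) (rho : R).
Hypotheses (hb : silver_coefs N b) (irrP : irreducible_poly (silver_poly N b)).
Hypotheses (rho_root : root (map_poly ratr (silver_poly N b)) rho) (hpisot : pisot rho).
Implicit Types (a f : nat -> R).

Let N_gt0 : (0 < N)%N. Proof. by case: hb => /ltnW. Qed.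
Let bN : b N. Proof. by case: hb. Qed.
Let rho_gt1 : 1 < rho. Proof. by case: hpisot. Qed.
Let rho_gt0 : 0 < rho. Proof. exact: lt_trans ltr01 rho_gt1. Qed.
Let rho_neq0 : rho != 0. Proof. by rewrite gt_eqF. Qed.
Let rhoX_neq0 k : rho ^+ k != 0. Proof. by rewrite expf_neq0. Qed.

Let rhoXVM k n : (k <= n)%N -> (rho ^+ k)^-1 * rho ^+ n = rho ^+ (n - k).
Proof. by move=> /subnK{1}<-; rewrite exprD mulrC mulfK. Qed.

Lemma silver_root_eq : rho ^+ N = \sum_(j < N) (b j.+1)%:R * rho ^+ (N - j.+1).
Proof.
have /rootP := rho_root; rewrite /silver_poly rmorphB rmorph_sum /= map_polyXn.
rewrite big_add1 /= big_mkord hornerD hornerN hornerXn => /eqP.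
rewrite subr_eq0 => /eqP->; rewrite horner_sum; apply: eq_bigr => j _.
by rewrite /= map_polyZ hornerZ map_polyXn hornerXn rmorph_nat.
Qed.

Lemma silver_poly_monic : silver_poly N b \is monic.
Proof.
rewrite /silver_poly monicE lead_coefDl ?lead_coefXn // size_polyN size_polyXn ltnS.
apply: (leq_trans (size_sum _ _ _)); apply/bigmax_leqP_seq => j.
rewrite mem_index_iota => /andP[j_gt0 _] _.
rewrite (leq_trans (size_scale_leq _ _)) // size_polyXn.
by case: hb => N_gt1 _ _; lia.
Qed.

(* A sequence [a] stands for the vector of its first [N] entries, the coordinates of
   [value a] with respect to [1, rho^-1, ..., rho^-(N-1)]. *)
Definition value a : R := \sum_(k < N) a k / rho ^+ k.

(** Multiplication by [rho] sends [rho^-(k+1)] to [rho^-k] and [1] to the sum of the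
    [b_(j+1) rho^-j]. The factor [(k.+1 < N)] keeps entries from index [N] on out of the first
    [N]. *)
Definition mul_rho a (k : nat) : R := a k.+1 *+ (k.+1 < N) + (b k.+1)%:R * a 0%N.

Local Notation T := mul_rho.

Lemma value_mul_rho a : value (T a) = rho * value a.
Proof.
have relE : \sum_(j < N) (b j.+1)%:R / rho ^+ j = rho.
  apply: (mulIf (rhoX_neq0 N.-1)); rewrite -exprS prednK // silver_root_eq mulr_suml.
  apply: eq_bigr => j _; rewrite -mulrA; congr (_ * _).
  by rewrite rhoXVM ?subnS; [rewrite -!subn1 subnAC | have := ltn_ord j; lia].
rewrite /value /mul_rho; under eq_bigr do rewrite mulrDl mulrAC.
rewrite big_split -mulr_suml /= relE.
case: N N_gt0 => // n _; rewrite big_ord_recr /= ltnn mulr0n mul0r addr0.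
rewrite big_ord_recl /= expr0 divr1 mulrDr addrC; congr (_ + _); rewrite mulr_sumr.
apply: eq_bigr => k _; rewrite ltnS ltn_ord mulr1n /bump add1n exprS invfM.
by rewrite mulrCA mulVKf.
Qed.

Lemma value_iter m a : value (iter m T a) = rho ^+ m * value a.
Proof.
by elim: m => [|m IHm]; rewrite ?mul1r //= value_mul_rho IHm exprS mulrA.
Qed.

Lemma value_lin x y a f : value (fun k => x * a k + y * f k) = x * value a + y * value f.
Proof.
rewrite /value !mulr_sumr -big_split; apply: eq_bigr => k _ /=.
by rewrite mulrDl -!mulrA.
Qed.

Lemma iter_lin x y a f m :
  iter m T (fun k => x * a k + y * f k) = (fun k => x * iter m T a k + y * iter m T f k).
Proof.
elim: m => //= m ->; apply/funext => k; rewrite /mul_rho.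
by rewrite mulrnDl -!mulrnAr; ring.
Qed.

Lemma iter_int a m k :
  (forall k, a k \is a Num.int) -> iter m T a k \is a Num.int.
Proof.
move=> a_int; elim: m k => //= m IHm k; rewrite /mul_rho rpredD ?rpredMn //.
by rewrite rpredM // natr_int.
Qed.

(** Eigenvector of [mul_rho] for [rho] with entry 0 equal to 1, solved from
    [rho v_k = v_(k+1) + b_(k+1)] and [v_N = 0]. *)
Definition eigvec (k : nat) : R := \sum_(k <= j < N) (b j.+1)%:R / rho ^+ (j.+1 - k).

Lemma eigvec0 : eigvec 0 = 1.
Proof.
rewrite /eigvec big_mkord; apply: (mulIf (rhoX_neq0 N)); rewrite mul1r [RHS]silver_root_eq.
rewrite mulr_suml; apply: eq_bigr => j _; rewrite -mulrA; congr (_ * _).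
by rewrite subn0 rhoXVM.
Qed.

Lemma eigvec_rec k : (k < N)%N -> rho * eigvec k = eigvec k.+1 + (b k.+1)%:R.
Proof.
move=> ltkN; rewrite /eigvec big_ltn // mulrDr addrC; congr (_ + _); last first.
  by rewrite subSnn expr1 mulrC divfK.
rewrite mulr_sumr; apply: eq_big_nat => j /andP[ltkj _].
by rewrite subSS subSn ?(ltnW ltkj) // exprS invfM mulrCA mulVKf.
Qed.

(** Each of these tails contains the term of [b N], which is 1. *)
Lemma eigvec_gt0 k : (k < N)%N -> 0 < eigvec k.
Proof.
move=> ltkN; rewrite /eigvec -(ltn_predK ltkN) big_nat_recr /=; last by lia.
rewrite (ltn_predK ltkN) bN mul1r ltr_wpDl ?invr_gt0 ?exprn_gt0 //.
by apply: sumr_ge0 => j _; rewrite divr_ge0 ?exprn_ge0 ?ler0n ?ltW.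
Qed.

Lemma eigvecN : eigvec N = 0. Proof. by rewrite /eigvec big_geq. Qed.

Lemma mul_rho_eigvec k : (k < N)%N -> T eigvec k = rho * eigvec k.
Proof.
move=> ltkN; rewrite eigvec_rec // /mul_rho eigvec0 mulr1; congr (_ + _).
by case: ltnP => // leNk; rewrite (_ : k.+1 = N) ?eigvecN //; lia.
Qed.

Lemma iter_eigvec m k : (k < N)%N -> iter m T eigvec k = rho ^+ m * eigvec k.
Proof.
elim: m k => [|m IHm] k ltkN; first by rewrite mul1r.
rewrite /= exprSr -mulrA -mul_rho_eigvec // /mul_rho (IHm 0%N) // mulrDr mulrCA.
by congr (_ + _); case: ltnP => // ltkN'; rewrite ?mulr0 // !mulr1n IHm.
Qed.

Lemma value_eigvec_gt0 : 0 < value eigvec.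
Proof.
rewrite /value -(ltn_predK N_gt0) big_ord_recl expr0 divr1 /= eigvec0 ltr_wpDr //.
apply: sumr_ge0 => j _; rewrite divr_ge0 ?exprn_ge0 ?(ltW rho_gt0) // ltW //.
by apply: eigvec_gt0; have := ltn_ord j; rewrite /bump; lia.
Qed.

(** Entry [i] moves up to the head in [i] steps, each adding a multiple of the head at that time. *)
Lemma iter_head a m i : (i < N)%N -> iter (m + i) T a 0%N =
  iter m T a i + \sum_(j < i) (b j.+1)%:R * iter (m + i - j.+1) T a 0%N.
Proof.
elim: i m => [|i IHi] m ltiN; first by rewrite big_ord0 addn0 addr0.
rewrite addnS -addSn (IHi m.+1 (ltnW ltiN)) /= {1}/mul_rho ltiN mulr1n -addrA.
congr (_ + _); rewrite big_ord_recr /= addrC; congr (_ + _) => //.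
by rewrite addSnnS addnK.
Qed.

Lemma iter_rec a m :
  iter (m + N) T a 0%N = \sum_(j < N) (b j.+1)%:R * iter (m + N - j.+1) T a 0%N.
Proof.
have sumE (F : nat -> R) : \sum_(j < N) F j = \sum_(j < N.-1) F j + F N.-1.
  by case: N N_gt0 => // n _; rewrite big_ord_recr.
have NE := prednK N_gt0.
rewrite (sumE (fun j => (b j.+1)%:R * iter (m + N - j.+1) T a 0%N)) /= NE addnK.
(* [iter_head] is used from time [m.+1] with [i = N.-1]; the last entry at that time is [b N] times
   the head at time [m], the missing term of the sum. *)
have mNE : (m + N = m.+1 + N.-1)%N by rewrite addSnnS NE.
rewrite {1}mNE iter_head ?NE //= {1}/mul_rho NE ltnn mulr0n add0r addrC.
by rewrite -mNE.
Qed.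

Lemma shift_op_iter a m :
  shift_op (map_poly ratr (silver_poly N b)) (fun i => ((iter i T a 0%N)%:C)%C) m
    = 0 :> complex R.
Proof.
have -> : map_poly ratr (silver_poly N b) =
    1 *: 'X^N + \sum_(j < N) (- (b j.+1)%:R) *: 'X^(N - j.+1) :> {poly complex R}.
  rewrite /silver_poly rmorphB rmorph_sum /= map_polyXn scale1r; congr (_ + _).
  rewrite big_add1 /= big_mkord -sumrN; apply: eq_bigr => j _.
  by rewrite /= map_polyZ map_polyXn rmorph_nat scaleNr.
rewrite shift_opD shift_op_sum shift_opZXn mul1r iter_rec rmorph_sum -big_split big1 //.
move=> j _; rewrite shift_opZXn rmorphM rmorph_nat mulNr addnBA ?ltn_ord //.
exact: subrr.
Qed.

(** Replacing [f] by [T f - rho f] uses up the factor [X - rho] of the recurrence; the remaining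
    roots lie in the open unit disc. *)
Lemma summable_head f :
  summable_seq (fun m => iter m T (fun k => 1 * T f k + - rho * f k) 0%N).
Proof.
have [rs PE rs_lt1] := pisot_splitting silver_poly_monic irrP rho_root hpisot.
apply: complex_summable; apply: (summable_seq_roots rs_lt1) => m.
have := shift_op_iter f m; rewrite PE shift_op_XsubC => <-.
congr (shift_op _ _ m); apply/funext => i.
by rewrite iter_lin -iterSr rmorphD !rmorphM rmorphN rmorph1 mul1r mulNr.
Qed.

Lemma summable_coord f :
  summable_seq (fun m => iter m T f 0%N) ->
  forall k, (k < N)%N -> summable_seq (fun m => iter m T f k).
Proof.
move=> sum0; elim=> [|k IHk] ltkN //.
have := summable_seqD (summable_seq_shift (IHk (ltnW ltkN)))
                      (summable_seqZ (- (b k.+1)%:R) sum0).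
congr summable_seq; apply/funext => m.
by rewrite /= {1}/mul_rho ltkN mulNr addrK.
Qed.

(* With [e k := f k - f 0 * eigvec k] and [d := T f - rho f] one has
   [rho * e k = e k.+1 - d k] and [e N = 0], so the [e k] are controlled by the [d k];
   and [value f = 0] then controls [f 0] since [value eigvec != 0]. *)
Lemma summable_iter f : value f = 0 ->
  forall k, (k < N)%N -> summable_seq (fun m => iter m T f k).
Proof.
move=> f0; pose d k := 1 * T f k + - rho * f k.
have sum_d := summable_coord (summable_head f).
pose e k m := iter m T f k - iter m T f 0%N * eigvec k.
have eE k m : (k < N)%N -> rho * e k m = e k.+1 m *+ (k.+1 < N) - iter m T d k.
  move=> ltkN; rewrite iter_lin -iterSr /= {1}/mul_rho /e mulrBr mulrCA eigvec_rec //.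
  case: ltnP => ltkN' /=; rewrite ?mulr1n ?mulr0n; first by ring.
  by rewrite (_ : k.+1 = N) ?eigvecN; [ring | lia].
(* Downward induction on [k], with [i = N - 1 - k]. *)
have sum_e i k : (k + i.+1 = N)%N -> summable_seq (e k).
  elim: i k => [|i IHi] k kiN.
    have ltkN : (k < N)%N by lia.
    have := summable_seqZ (- rho^-1) (sum_d _ ltkN); congr summable_seq.
    apply/funext => m; apply: (mulfI rho_neq0); rewrite eE //.
    rewrite (_ : (k.+1 < N)%N = false) ?mulr0n ?sub0r; last by lia.
    by rewrite mulrA mulrN mulfV // mulN1r.
  have ltkN : (k < N)%N by lia.
  have := summable_seqD (summable_seqZ rho^-1 (IHi k.+1 ltac:(lia)))
                        (summable_seqZ (- rho^-1) (sum_d _ ltkN)); congr summable_seq.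
  apply/funext => m; apply: (mulfI rho_neq0); rewrite eE //.
  rewrite (_ : (k.+1 < N)%N = true) ?mulr1n; last by lia.
  by rewrite mulrDr !mulrA mulrN mulfV // mul1r mulN1r.
have {}sum_e k : (k < N)%N -> summable_seq (e k).
  by move=> ltkN; apply: (sum_e (N - k.+1)%N); lia.
have sum_0 : summable_seq (fun m => iter m T f 0%N).
  have := summable_seqZ (- (value eigvec)^-1) (@summable_seq_sum _ N
    (fun k m => (rho ^+ k)^-1 * e k m) (fun k ltkN => summable_seqZ _ (sum_e k ltkN))).
  congr summable_seq; apply/funext => m.
  have := value_iter m f; rewrite f0 mulr0 => val0.
  have -> : \sum_(k < N) (rho ^+ k)^-1 * e k m = - (iter m T f 0%N * value eigvec).
    have := value_lin 1 (- iter m T f 0%N) (iter m T f) eigvec.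
    rewrite val0 mulr0 add0r mulNr => <-; apply: eq_bigr => k _.
    by rewrite mul1r mulNr mulrC.
  by rewrite mulrNN mulrC mulfK // lt0r_neq0 // value_eigvec_gt0.
move=> k ltkN; have := summable_seqD (sum_e k ltkN) (summable_seqZ (eigvec k) sum_0).
by congr summable_seq; apply/funext => m; rewrite /e mulrC subrK.
Qed.

(** Projection along [eigvec] onto the vectors of value 0; the factor [1] matches the shape of
    [value_lin] and [iter_lin]. *)
Definition residue a (k : nat) : R := 1 * a k + - (value a / value eigvec) * eigvec k.

Lemma value_residue a : value (residue a) = 0.
Proof.
rewrite /residue value_lin mul1r mulNr divfK ?subrr //.
by rewrite gt_eqF // value_eigvec_gt0.
Qed.

Lemma iter_decomp a m k : (k < N)%N ->
  iter m T a k = value a / value eigvec * rho ^+ m * eigvec k + iter m T (residue a) k.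
Proof. by move=> ltkN; rewrite /residue iter_lin iter_eigvec //; ring. Qed.

(** A weak Bernoulli inequality, giving explicit thresholds for the growth of [rho ^+ m]. *)
Lemma natM_le_expr m : m%:R * (rho - 1) <= rho ^+ m.
Proof.
elim: m => [|m IHm]; first by rewrite mul0r expr0.
have : 1 <= rho ^+ m by rewrite exprn_ege1 // ltW.
have := rho_gt1; rewrite exprS -natr1; nra.
Qed.

(** The component along the positive [eigvec] grows like [rho ^+ m], while the iterates of the
    residue stay bounded. *)
Lemma iter_eventually_gt0 a : 0 < value a ->
  \forall m \near \oo, forall k, (k < N)%N -> 0 < iter m T a k.
Proof.
move=> a_gt0; suff: \forall m \near \oo, forall k : 'I_N, 0 < iter m T a k.
  by apply: filterS => m am_gt0 k ltkN; have := am_gt0 (Ordinal ltkN).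
apply: filter_forall => k.
have [B hB] := summable_seq_bounded (summable_iter (value_residue a) (ltn_ord k)).
pose C := value a / value eigvec * eigvec k.
have C_gt0 : 0 < C by rewrite mulr_gt0 ?divr_gt0 ?value_eigvec_gt0 ?eigvec_gt0.
have Cr_gt0 : 0 < C * (rho - 1) by rewrite mulr_gt0 // subr_gt0.
exists (Num.bound (B / (C * (rho - 1)))) => //= m /= le_m.
rewrite iter_decomp // mulrAC -/C.
have B_ge0 : 0 <= B by apply: le_trans (hB 0%N).
have ltB : B < m%:R * (C * (rho - 1)).
  rewrite -ltr_pdivrMr //; apply: lt_le_trans (archi_boundP _) _.
    by rewrite divr_ge0 // ltW.
  by rewrite ler_nat.
have := natM_le_expr m; rewrite -(ler_pM2l C_gt0) => leC.
have := hB m; rewrite ler_norml => /andP[leB _].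
by nra.
Qed.

(** * Greedy expansions and gaps between rho-integers *)

Lemma silver_number_lt2 : rho < 2.
Proof.
(* Bounding all [b_j] by 1 leaves a geometric sum, so [(rho - 1) rho^N <= rho^N - 1]. *)
have le_geom : rho ^+ N <= \sum_(i < N) rho ^+ i.
  rewrite silver_root_eq (reindex_inj rev_ord_inj) /=; apply: ler_sum => i _.
  rewrite subnSK // subKn ?(ltnW (ltn_ord i)) //.
  by case: (b _); rewrite ?mul1r ?mul0r // exprn_ge0 // ltW.
have := subrX1 rho N; have : 0 < rho ^+ N by rewrite exprn_gt0.
have := rho_gt1; nra.
Qed.

(** Indexing digits by exponent and padding with zeros lets two rho-integers be subtracted
    digitwise. *)
Lemma rho_integers_digits x : rho_integers rho x ->
  exists n (c : nat -> bool), forall q, (n <= q)%N -> x = \sum_(i < q) (c i)%:R * rho ^+ i.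
Proof.
move=> [_ [n [c ->]]]; exists n.+1, (fun i => (i < n.+1)%N && c (inord (n - i))) => q leq.
transitivity (\sum_(i < n.+1) ((i < n.+1)%N && c (inord (n - i)))%:R * rho ^+ i).
  rewrite [LHS](reindex_inj rev_ord_inj) /=; apply: eq_bigr => i _.
  rewrite ltn_ord subSS subKn ?leq_ord //=; congr ((c _)%:R * _).
  by apply: val_inj; rewrite /= inordK ?subSS // ltnS leq_subr.
rewrite (big_ord_widen _ (fun i => ((i < n.+1)%N && c (inord (n - i)))%:R * rho ^+ i) leq).
by rewrite big_mkcond; apply: eq_bigr => i _; case: ltnP => //=; rewrite mul0r.
Qed.

Lemma digits_rho_integers n (c : nat -> bool) :
  rho_integers rho (\sum_(i < n) (c i)%:R * rho ^+ i).
Proof.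
split; first by apply: sumr_ge0 => i _; rewrite mulr_ge0 // exprn_ge0 // ltW.
case: n => [|n].
  by exists 0%N, (fun=> false); rewrite big_ord0 big1 // => i _; rewrite mul0r.
exists n, (fun i => c (n - i)%N); rewrite (reindex_inj rev_ord_inj) /=.
by apply: eq_bigr => i _; rewrite subSS.
Qed.

(** The top digit is 1 exactly when [t >= rho^n]; the rest [t - rho^n] is then below [rho^n] because
    [rho < 2]. *)
Lemma greedy_expansion n t : 0 <= t < rho ^+ n ->
  exists c : nat -> bool, let e := \sum_(i < n) (c i)%:R * rho ^+ i in e <= t < e + 1.
Proof.
elim: n t => [|n IHn] t /andP[t_ge0 lt_t].
  by exists (fun=> false); rewrite /= big_ord0 t_ge0 add0r.
have [lt_tn|le_nt] := ltP t (rho ^+ n).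
  have [|c hc] := IHn t; first by rewrite t_ge0.
  exists (fun i => (i < n)%N && c i) => /=; rewrite big_ord_recr /= ltnn mul0r addr0.
  by under eq_bigr do rewrite ltn_ord.
have [|c hc] := IHn (t - rho ^+ n).
  rewrite subr_ge0 le_nt /=; have := silver_number_lt2.
  have : 0 < rho ^+ n by rewrite exprn_gt0.
  by move: lt_t; rewrite exprS; nra.
exists (fun i => (i == n) || c i) => /=; rewrite big_ord_recr /= eqxx mul1r.
under eq_bigr do rewrite (ltn_eqF (ltn_ord _)).
by move: hc => /=; set e := \sum_(i < n) _; rewrite lerBrDr ltrBlDr addrAC.
Qed.

Lemma rho_integers_gap x : rho_integers rho x ->
  exists2 y, rho_integers rho y & x < y <= x + 1.
Proof.
move=> [x_ge0 _]; have x1_ge0 : 0 <= x + 1 by rewrite addr_ge0.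
have r1_gt0 : 0 < rho - 1 by rewrite subr_gt0.
pose n := Num.bound ((x + 1) / (rho - 1)).
have lt_n : x + 1 < rho ^+ n.
  apply: lt_le_trans (natM_le_expr n); rewrite -ltr_pdivrMr //.
  by apply: archi_boundP; rewrite divr_ge0 // ltW.
(* The greedy value [e] of [x + 1] satisfies [e <= x + 1 < e + 1], hence [x < e]. *)
have [|c /andP[le_e lt_e]] := @greedy_expansion n (x + 1); first by rewrite x1_ge0.
exists (\sum_(i < n) (c i)%:R * rho ^+ i); first exact: digits_rho_integers.
by rewrite le_e andbT -(ltrD2r 1).
Qed.

(** * Finiteness of the small differences *)

Definition unit_coord (k : nat) : R := (k == 0%N)%:R.

Lemma value_unit_coord : value unit_coord = 1.
Proof.
rewrite /value; case: N N_gt0 => // n _; rewrite big_ord_recl /= divr1 big1 ?addr0 //.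
by move=> i _; rewrite /unit_coord mul0r.
Qed.

(* The contribution of the digits to each coordinate is the one along [eigvec], which is
   proportional to the value, plus a part dominated by an absolutely convergent series. *)
Lemma bounded_coords : exists M : nat, forall n (c : nat -> R),
  (forall i, c i \is a Num.int) -> (forall i, `|c i| <= 1) ->
  `|\sum_(i < n) c i * rho ^+ i| <= 1 ->
  exists a, [/\ forall k, a k \is a Num.int, forall k, (k < N)%N -> `|a k| <= M%:R &
    value a = \sum_(i < n) c i * rho ^+ i].
Proof.
pose f := residue unit_coord.
have [B hB] : summable_seq (fun m => \sum_(k < N) `|iter m T f k|).
  apply: (summable_seq_sum (F := fun k m => `|iter m T f k|)) => k ltkN.
  have [B hB] := summable_iter (value_residue unit_coord) ltkN; exists B => n.
  by under eq_bigr do rewrite normr_id.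
have {}hB k n : (k < N)%N -> \sum_(m < n) `|iter m T f k| <= B.
  move=> ltkN; apply: le_trans (hB n); apply: ler_sum => m _.
  apply: le_trans (ler_norm _); rewrite (bigD1 (Ordinal ltkN)) //=.
  by rewrite lerDl sumr_ge0.
pose E := \sum_(k < N) eigvec k.
have leE k : (k < N)%N -> eigvec k <= E.
  move=> ltkN; rewrite /E (bigD1 (Ordinal ltkN)) //= lerDl sumr_ge0 // => i _.
  by rewrite ltW // eigvec_gt0.
have E_ge0 : 0 <= E by apply: sumr_ge0 => i _; rewrite ltW // eigvec_gt0.
have v_gt0 := value_eigvec_gt0.
have B_ge0 : 0 <= B by have := hB _ 0%N N_gt0; rewrite big_ord0.
exists (Num.bound ((value eigvec)^-1 * E + B)) => n c c_int c_le1 x_le1.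
(* Each [rho ^+ i] is replaced by its integer coordinates, the [i]-th iterate of those of 1. *)
exists (fun k => \sum_(i < n) c i * iter i T unit_coord k); split.
- move=> k; apply: rpred_sum => i _; rewrite rpredM // iter_int // => j.
  exact: natr_int.
- move=> k ltkN; apply: (le_trans (y := (value eigvec)^-1 * E + B)); last first.
    by apply/ltW/archi_boundP; rewrite addr_ge0 // mulr_ge0 // invr_ge0 ltW.
  have -> : \sum_(i < n) c i * iter i T unit_coord k =
      (value eigvec)^-1 * eigvec k * (\sum_(i < n) c i * rho ^+ i) +
      \sum_(i < n) c i * iter i T f k.
    rewrite mulr_sumr -big_split; apply: eq_bigr => i _ /=.
    by rewrite iter_decomp // value_unit_coord; ring.
  apply: le_trans (ler_normD _ _) _; apply: lerD.
    rewrite normrM ger0_norm; last first.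
      by rewrite mulr_ge0 ?invr_ge0 ?ltW ?eigvec_gt0.
    apply: (le_trans (y := (value eigvec)^-1 * eigvec k)).
      by rewrite ler_piMr // mulr_ge0 ?invr_ge0 ?ltW ?eigvec_gt0.
    by rewrite ler_wpM2l ?leE // invr_ge0 ltW.
  apply: le_trans (ler_norm_sum _ _ _) _; apply: le_trans (hB k n ltkN).
  by apply: ler_sum => i _; rewrite normrM ler_piMl.
- rewrite /value; under eq_bigr do rewrite mulr_suml.
  rewrite exchange_big; apply: eq_bigr => i _ /=.
  have := value_iter i unit_coord; rewrite value_unit_coord mulr1 => <-.
  by rewrite /value mulr_sumr; apply: eq_bigr => k _; rewrite mulrA.
Qed.

Definition small_differences : set R :=
  [set x | difference_set (rho_integers rho) x /\ `|x| <= 1].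

Lemma small_differences_coords : exists M : nat, forall x, small_differences x ->
  exists a, [/\ forall k, a k \is a Num.int, forall k, (k < N)%N -> `|a k| <= M%:R &
    value a = x].
Proof.
have [M hM] := bounded_coords; exists M => x [[y [z [hy hz ->]]]].
have [n [c yE]] := rho_integers_digits hy; have [p [d zE]] := rho_integers_digits hz.
rewrite (yE _ (leq_maxl n p)) (zE _ (leq_maxr n p)) -sumrB.
under eq_bigr do rewrite -mulrBl.
apply: (hM _ (fun i => (c i)%:R - (d i)%:R)) => i; first by rewrite rpredB ?natr_int.
by case: (c i); case: (d i); rewrite ?subrr ?subr0 ?sub0r ?normrN ?normr1 ?normr0.
Qed.

(** Their coordinate vectors are integral with entries in [[-M, M]]; adding [M] indexes them by
    ordinals below [2M + 1]. *)
Lemma finite_small_differences : finite_set small_differences.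
Proof.
have [M hM] := small_differences_coords.
pose F (t : {ffun 'I_N -> 'I_(M + M).+1}) := \sum_(k < N) ((t k)%:R - M%:R) / rho ^+ k.
apply: (@sub_finite_set _ _ (F @` [set: {ffun 'I_N -> 'I_(M + M).+1}])); last first.
  exact/finite_image/finite_finset.
move=> x /hM[a [a_int a_le <-]].
exists [ffun k : 'I_N => inord (Num.truncn (a k + M%:R))] => //.
apply: eq_bigr => k _; rewrite ffunE; congr (_ / _).
have := a_le k (ltn_ord k); rewrite ler_norml => /andP[ge_a le_a].
have aM_ge0 : 0 <= a k + M%:R by lra.
have aM_nat : a k + M%:R \is a Num.nat by rewrite natrEint aM_ge0 rpredD ?natr_int.
rewrite inordK ?truncnK ?addrK //.
by rewrite ltnS -(ler_nat R) truncnK // natrD lerD2r.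
Qed.

(** The [n k] are the coordinates of [rho^m x]. Holding for all large [m], the claim allows one [m]
    for finitely many [x]. *)
Lemma positive_coords x : small_differences x -> 0 < x ->
  \forall m \near \oo, exists n : nat -> nat,
    (forall k, (k < N)%N -> (0 < n k)%N) /\
    x = \sum_(k < N) (n k)%:R * (rho ^- m / rho ^+ k).
Proof.
have [M hM] := small_differences_coords => /hM[a [a_int _ <-]] /iter_eventually_gt0.
apply: filterS => m am_gt0; exists (fun k => Num.truncn (iter m T a k)).
have am_nat k : (k < N)%N -> iter m T a k \is a Num.nat.
  by move=> ltkN; rewrite natrEint iter_int //= ltW ?am_gt0.
split=> [k ltkN|]; first by rewrite -(ltr_nat R) truncnK ?am_nat ?am_gt0.
apply: (mulfI (rhoX_neq0 m)); rewrite -value_iter mulr_sumr; apply: eq_bigr => k _.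
by rewrite truncnK ?am_nat // mulrCA mulVKf.
Qed.

End Companion.

(** * Building and refining tilings *)

Section Tilings.
Variable R : realType.
Implicit Types (A : set R) (y : nat -> R).

Lemma finite_set_min A : finite_set A -> A !=set0 ->
  exists2 m, A m & forall z, A z -> m <= z.
Proof.
move=> /finite_seqP[s ->] {A}; elim: s => [|x s IHs] [z /=]; first by rewrite in_nil.
move=> _; case: (pselect ([set` s] !=set0)) => [/IHs[m /= ms m_min]|s0].
  exists (Num.min x m) => /= [|w]; rewrite inE.
    by rewrite /Num.min; case: ifP; rewrite ?eqxx // ms orbT.
  by case/orP=> [/eqP->|/m_min le_mw]; rewrite ge_min ?lexx // le_mw orbT.
exists x => /= [|w]; first exact: mem_head.
by rewrite inE => /orP[/eqP->//|ws]; case: s0; exists w.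
Qed.

Lemma step_ge_lb y (delta : R) : (forall i, y i + delta <= y i.+1) ->
  forall n, y 0%N + n%:R * delta <= y n.
Proof.
move=> hy; elim=> [|n IHn]; first by rewrite mul0r addr0.
by apply: le_trans (hy n); rewrite -natr1 mulrDl mul1r addrA lerD2r.
Qed.

Lemma step_ge_exists_lt y (delta x : R) : 0 < delta ->
  (forall i, y i + delta <= y i.+1) ->
  exists n0, forall n, (n0 <= n)%N -> x < y n.
Proof.
move=> delta_gt0 hy; exists (Num.bound (`|x - y 0%N| / delta)) => n le_n.
apply: lt_le_trans (step_ge_lb hy n); rewrite -ltrBlDl -ltr_pdivrMr //.
apply: (@le_lt_trans _ _ (`|x - y 0%N| / delta)).
  by rewrite ler_pM2r ?invr_gt0 // ler_norm.
apply: lt_le_trans (archi_boundP _) _; first by rewrite divr_ge0 // ltW.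
by rewrite ler_nat.
Qed.

Lemma step_ge_cvgy y (delta : R) : 0 < delta -> (forall i, y i + delta <= y i.+1) ->
  y @ \oo --> +oo.
Proof.
move=> delta_gt0 hy; apply/cvgryPge => x.
have [n0 hn0] := step_ge_exists_lt x delta_gt0 hy.
by exists n0 => //= n /= /hn0/ltW.
Qed.

Lemma tiling_of_set A (G := [set d | difference_set A d /\ `|d| <= 1]) :
    A 0 -> (forall x, A x -> 0 <= x) ->
    (forall x, A x -> exists2 y, A y & x < y <= x + 1) -> finite_set G ->
  exists y, [/\ tiling y, endpoints y = A &
    forall i, G (y i.+1 - y i) /\ 0 < y i.+1 - y i].
Proof.
move=> A0 A_ge0 A_gap Gfin.
have Gsub (Q : set R) : finite_set (G `&` Q).
  by apply: sub_finite_set Gfin; apply: subIsetl.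
have GP x z : A x -> A z -> x < z <= x + 1 -> G (z - x).
  move=> Ax Az /andP[ltxz lezx]; split; first by exists z, x.
  by rewrite ger0_norm ?lerBlDl // subr_ge0 ltW.
(* [delta] is the least positive element of [G], hence a lower bound for all gaps. *)
have [delta [_ delta_gt0] delta_min] :
    exists2 d, (G `&` [set d | 0 < d]) d & forall z, (G `&` [set d | 0 < d]) z -> d <= z.
  apply: finite_set_min => //; have [z Az hz] := A_gap _ A0; exists (z - 0).
  by split; [apply: GP | rewrite /= subr_gt0; case/andP: hz].
(* [s] is the successor function of [A], with default 0 off [A]; it exists because [G] is finite and
   some point of [A] lies in []x, x + 1]]. *)
have /choice[s hs] (x : R) : exists z, A x ->
    [/\ A z, x < z, G (z - x) & forall w, A w -> x < w -> z <= w].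
  have [Ax|] := pselect (A x); last by exists 0.
  have [z Az hz] := A_gap _ Ax.
  have [|d [Gd [d_gt0 Axd]] d_min] :=
      @finite_set_min (G `&` [set d | 0 < d /\ A (x + d)]) (Gsub _).
    exists (z - x); split; first exact: GP.
    by rewrite /= subr_gt0 addrC subrK; split=> //; case/andP: hz.
  exists (x + d) => _; split=> //; rewrite ?ltrDl // [x + d]addrC ?addrK // => w Aw ltxw.
  have [lewx|ltxw1] := lerP w (x + 1); last first.
    apply: le_trans (ltW ltxw1); rewrite addrC lerD2l; case: Gd => _.
    by apply: le_trans; apply: ler_norm.
  rewrite -lerBrDr; apply: d_min; split; first by apply: GP => //; rewrite ltxw.
  by rewrite /= subr_gt0 addrC subrK.
pose y i := iter i s 0.
have Ay i : A (y i) by elim: i => //= i /hs[].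
have y_lt i : y i < y i.+1 by case: (hs _ (Ay i)).
have Gy i : G (y i.+1 - y i) by case: (hs _ (Ay i)).
have y_step i : y i + delta <= y i.+1.
  rewrite -lerBrDl; apply: delta_min; split; first exact: Gy.
  by rewrite /mkset subr_gt0.
exists y; split; last by move=> i; rewrite subr_gt0.
  split=> //; first exact: step_ge_cvgy delta_gt0 y_step.
  by apply: sub_finite_set Gfin => _ [i _ <-].
apply/seteqP; split=> [_ [i _ <-]//|z Az].
have ex_n : exists n, z < y n.
  by have [n hn] := step_ge_exists_lt z delta_gt0 y_step; exists n; apply: hn.
(* At the first [n.+1] with [z < y n.+1], minimality gives [y n <= z], and no point of [A] lies
   strictly between [y n] and its successor. *)
case: (ex_minnP ex_n) => -[|n]; first by rewrite ltNge A_ge0.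
move=> ltz n_min; exists n => //; apply/eqP; rewrite eq_le leNgt.
apply/andP; split; first by apply/negP => /n_min; rewrite ltnn.
rewrite leNgt; apply/negP => ltyz; have [_ _ _ /(_ _ Az ltyz)] := hs _ (Ay n).
by rewrite leNgt ltz.
Qed.

Lemma refine_tiling y' (l : nat -> seq R) (delta : R) :
    0 < delta -> y' 0%N = 0 -> (forall i, (0 < size (l i))%N) ->
    (forall i, y' i.+1 = y' i + \sum_(d <- l i) d) ->
    (forall i d, d \in l i -> delta <= d) ->
    finite_set [set d | exists i, d \in l i] ->
  exists y, [/\ tiling y, subordinate y' y &
    prototile_lengths y = [set d | exists i, d \in l i]].
Proof.
move=> delta_gt0 y'0 l_gt0 y'S l_ge lfin.
(* A state [(i, j)] is piece [j] of tile [i]; [next] walks through the pieces tile by tile, and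
   [pos] is the left endpoint. *)
pose next (p : nat * nat) :=
  if (p.2.+1 < size (l p.1))%N then (p.1, p.2.+1) else (p.1.+1, 0%N).
pose pos (p : nat * nat) := y' p.1 + \sum_(d <- take p.2 (l p.1)) d.
pose st n := iter n next (0%N, 0%N).
have st_lt n : ((st n).2 < size (l (st n).1))%N.
  by elim: n => [|n IHn]; rewrite //= /next; case: ifP => //= _; apply: l_gt0.
have posS n : pos (st n.+1) = pos (st n) + nth 0 (l (st n).1) (st n).2.
  have lt_n := st_lt n; rewrite /= /next /pos.
  have takeS := take_nth 0 lt_n; case: ifP => [_|/negbT ge_n] /=.
    by rewrite takeS big_rcons /= addrA.
  rewrite take0 big_nil addr0 y'S -addrA; congr (_ + _).
  have lE : l (st n).1 = rcons (take (st n).2 (l (st n).1)) (nth 0 (l (st n).1) (st n).2).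
    by rewrite -takeS take_oversize // leqNgt.
  by rewrite [in LHS]lE big_rcons.
have reach i j : (j < size (l i))%N -> exists n, st n = (i, j).
  elim: i j => [|i IHi] j.
    elim: j => [|j IHj] ltj; first by exists 0%N.
    by have [n stn] := IHj (ltnW ltj); exists n.+1; rewrite /= stn /next /= ltj.
  elim: j => [|j IHj] ltj; last first.
    by have [n stn] := IHj (ltnW ltj); exists n.+1; rewrite /= stn /next /= ltj.
  have [|n stn] := IHi (size (l i)).-1; first by rewrite prednK.
  by exists n.+1; rewrite /= stn /next /= prednK // ltnn.
have gapE n : pos (st n.+1) - pos (st n) = nth 0 (l (st n).1) (st n).2.
  by rewrite posS addrC addKr.
have lengthsE : prototile_lengths (pos \o st) = [set d | exists i, d \in l i].
  apply/seteqP; split=> [_ [n _ <-]|d [i d_li]] /=.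
    by exists (st n).1; rewrite gapE mem_nth.
  have [|n stn] := reach i (index d (l i)); first by rewrite index_mem.
  by exists n; rewrite //= gapE stn /= nth_index.
have pos_step n : (pos \o st) n + delta <= (pos \o st) n.+1.
  by rewrite /= posS lerD2l; apply: (l_ge (st n).1); rewrite mem_nth.
exists (pos \o st); split=> //.
  split; rewrite ?lengthsE //.
  - by rewrite /= /pos /= y'0 take0 big_nil addr0.
  - by move=> n; apply: lt_le_trans (pos_step n); rewrite ltrDl.
  - exact: step_ge_cvgy delta_gt0 pos_step.
move=> _ [i _ <-]; have [n stn] := reach i 0%N (l_gt0 i); exists n => //=.
by rewrite stn /pos take0 big_nil addr0.
Qed.

End Tilings.

(** * Cutting the gaps, and the equivalence *)

Lemma mem_flatten_nseq (T : eqType) (F : nat -> T) (n : nat -> nat) N x :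
  reflect (exists k, [/\ (k < N)%N, (0 < n k)%N & x = F k])
          (x \in flatten [seq nseq (n k) (F k) | k <- iota 0 N]).
Proof.
apply: (iffP flatten_mapP) => [[k]|[k [ltkN nk ->]]].
  by rewrite mem_iota mem_nseq /= => ltkN /andP[nk /eqP->]; exists k.
by exists k; rewrite ?mem_iota // mem_nseq nk eqxx.
Qed.

Theorem theorem5p1 (R : realType) (N : nat) (b : nat -> bool) (rho : R)
    (hb : silver_coefs N b)
    (hirr : irreducible_poly (silver_poly N b))
    (hrho : is_silver_number (silver_poly N b) rho)
    (hpisot : pisot rho) :
  (exists L : R, 0 < L /\
     exists y' y : nat -> R,
       [/\ tiling y', endpoints y' = rho_integers rho,
           tiling y, subordinate y' y &
           prototile_lengths y = [set L / rho ^+ k | k in [set k | (k < N)%N]]])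
  <->
  ~ limit_point (difference_set (rho_integers rho)) 0.
Proof.
have [N_gt1 _ _] := hb; have [_ rho_root _] := hrho; have [_ rho_gt1 _] := hpisot.
have N_gt0 := ltnW N_gt1; have rho_gt0 : 0 < rho := lt_trans ltr01 rho_gt1.
have Gfin := finite_small_differences hb hirr rho_root hpisot.
split=> [_ lim0|_].
  (* [delta] is the least absolute value of a nonzero difference in [[-1, 1]]; the cluster point
     supplies one. *)
  have [||delta [_ delta_gt0] delta_min] := @finite_set_min R
      ([set `|x| | x in small_differences rho] `&` [set d | 0 < d]).
  - apply: sub_finite_set (finite_image Num.norm Gfin); exact: subIsetl.
  - have [y [y0 Dy]] := lim0 _ (nbhsx_ballx 0 1 ltr01).
    rewrite -ball_normE /= sub0r normrN => y_lt1.
    exists `|y|; split; last by rewrite /= normr_gt0.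
    by exists y => //; split=> //; apply: ltW.
  (* The cap at 1 keeps the next difference among the small ones, so that [delta_min] applies. *)
  have d1_gt0 : 0 < Num.min delta 1 by rewrite lt_min delta_gt0 ltr01.
  have [y [y0 Dy]] := lim0 _ (nbhsx_ballx 0 _ d1_gt0).
  rewrite -ball_normE /= sub0r normrN lt_min => /andP[y_lt y_lt1].
  have : delta <= `|y|.
    apply: delta_min; split; last by rewrite /= normr_gt0.
    by exists y => //; split=> //; apply: ltW.
  by rewrite leNgt y_lt.
have [y' [y'_til y'E y'G]] : exists y', [/\ tiling y', endpoints y' = rho_integers rho &
    forall i, small_differences rho (y' i.+1 - y' i) /\ 0 < y' i.+1 - y' i].
  apply: tiling_of_set => //.
  - by have := digits_rho_integers hpisot 0 (fun=> false); rewrite big_ord0.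
  - by move=> x [].
  - by move=> x; apply: rho_integers_gap rho_root hpisot x.
have [s GE] := (finite_seqP _).1 Gfin.
(* One [m] serves all positive members of the finite list [s], and so all gaps. *)
have /filter_ex[m hm] : \forall m \near \oo, forall j : 'I_(size s), 0 < s`_j ->
    exists n : nat -> nat, (forall k, (k < N)%N -> (0 < n k)%N) /\
      s`_j = \sum_(k < N) (n k)%:R * (rho ^- m / rho ^+ k).
  apply: filter_forall => j; have [sj_gt0|] := boolP (0 < s`_j); last by exists 0%N.
  have Gj : small_differences rho s`_j by rewrite GE /= mem_nth.
  by apply: filterS (positive_coords hb hirr rho_root hpisot Gj sj_gt0) => m hm _.
pose L := rho ^- m; have L_gt0 : 0 < L by rewrite invr_gt0 exprn_gt0.
have /choice[n hn] (i : nat) : exists n : nat -> nat,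
    (forall k, (k < N)%N -> (0 < n k)%N) /\
    y' i.+1 - y' i = \sum_(k < N) (n k)%:R * (L / rho ^+ k).
  have [Gi i_gt0] := y'G i; move: Gi; rewrite GE /= => si.
  have lti : (index (y' i.+1 - y' i)%R s < size s)%N by rewrite index_mem.
  by have := hm (Ordinal lti); rewrite /= nth_index //; apply.
pose F k := L / rho ^+ k.
pose l i := flatten [seq nseq (n i k) (F k) | k <- iota 0 N].
have lP i d : d \in l i <-> exists2 k, (k < N)%N & F k = d.
  split=> [/mem_flatten_nseq[k [ltkN _ ->]]|[k ltkN <-]]; first by exists k.
  by apply/mem_flatten_nseq; exists k; split=> //; apply: (hn i).1.
(* As all multiplicities are positive, tile 0 alone already contains every length. *)
have lE : [set d | exists i, d \in l i] = [set L / rho ^+ k | k in [set k | (k < N)%N]].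
  by apply/seteqP; split=> [d [i /lP]//|d hd]; exists 0%N; apply/lP.
(* [F N] is at most every piece length [F k] with [k < N]. *)
have [] := @refine_tiling R y' l (F N).
- by rewrite divr_gt0 ?exprn_gt0.
- by case: y'_til.
- move=> i; have : F 0%N \in l i by apply/lP; exists 0%N.
  by case: (l i).
- move=> i; rewrite -[LHS](subrK (y' i)) addrC (hn i).2; congr (_ + _).
  rewrite /l big_flatten big_map -(big_mkord xpredT (fun k => (n i k)%:R * F k)).
  rewrite /index_iota subn0; apply: eq_bigr => k _.
  by rewrite big_nseq iter_addr_0 mulr_natl.
- move=> i d /lP[k ltkN <-]; rewrite ler_pM2l // lef_pV2 ?posrE ?exprn_gt0 //.
  by rewrite ler_weXn2l ?(ltW rho_gt1) // ltnW.
- rewrite lE; apply: finite_image; exact: finite_II.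
move=> y [y_til sub_y yE]; exists L; split=> //; exists y', y; split=> //.
by rewrite yE lE.
Qed.
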